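(* Let $\Bbbk$ be a commutative unital ring and $n \geq 1$, $d \geq 2$ integers. Then $NC_A(n,d)$ is a free $\Bbbk$-module with basis consisting of the $n!\,(1+n(d-1))$ elements $\{T_w : w \in S_n\} \sqcup \{T_w T_n^k T_{n-1} T_{n-2} \cdots T_{m+1} T_m : w \in S_n,\ k \in [1,d-1],\ m \in [1,n]\}$ (where for $m = n$ the product $T_{n-1}\cdots T_m$ is empty). Moreover, for every $l \in [1,n-1]$, the subalgebra $R_l$ of $NC_A(n,d)$ generated by $T_1,\dots,T_l$ is isomorphic to the usual nil-Coxeter algebra of type $A_l$, i.e. the algebra generated by $T_1,\dots,T_l$ with the type $A$ braid relations and $T_i^2 = 0$ for all $i$.
   Context: $NC_A(n,d)$ is the $\Bbbk$-algebra generated by $T_1,\dots,T_n$ with relations $T_iT_{i+1}T_i = T_{i+1}T_iT_{i+1}$ for $0<i<n$, $T_iT_j = T_jT_i$ for $|i-j|>1$, $T_1^2 = \cdots = T_{n-1}^2 = 0$, and $T_n^d = 0$. The symmetric group $S_n$ is generated by simple transpositions $s_1,\dots,s_{n-1}$; for $w \in S_n$ with reduced expression $w = s_{i_1}\cdots s_{i_r}$, $T_w := T_{i_1}\cdots T_{i_r}$ (independent of the reduced expression by the braid relations). *)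

(* Defs.v *)
From HB Require Import structures.
From mathcomp Require Import all_boot all_order all_fingroup all_algebra.
Set Implicit Arguments. Unset Strict Implicit. Unset Printing Implicit Defensive.
Import GRing.Theory.
Local Open Scope ring_scope.

(* s_i = transposition of the points i-1 and i of 'I_n (i.e. of i and i+1 in 1-based numbering) *)
Definition sperm (n i : nat) : 'S_n :=
  match @insub _ (fun k => k < n)%N _ i.-1, @insub _ (fun k => k < n)%N _ i with
  | Some a, Some b => tperm a b
  | _, _ => 1%g
  end.

Definition word_perm (n : nat) (s : seq nat) : 'S_n :=
  (\prod_(i <- s) sperm n i)%g.

(* Coxeter length = number of inversions *)
Definition perm_length (n : nat) (w : 'S_n) : nat :=
  #|[set p : 'I_n * 'I_n | (p.1 < p.2)%N && (w p.2 < w p.1)%N]|.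

Definition reduced_word (n : nat) (w : 'S_n) (s : seq nat) : bool :=
  [&& all (fun i => 0 < i < n)%N s, size s == perm_length w & word_perm n s == w].

Definition rword (n : nat) (w : 'S_n) : seq nat :=
  head [::] [seq s <- [seq map (@nat_of_ord n) (val t)
                       | t <- enum {: (perm_length w).-tuple 'I_n}]
            | reduced_word w s].

Section Alg.
Variable R : comPzRingType.

Definition alg_morph (A B : algType R) (f : A -> B) : Prop :=
  [/\ forall (a : R) (x : A), f (a *: x) = a *: f x,
      forall x y : A, f (x + y) = f x + f y,
      f 1 = 1 &
      forall x y : A, f (x * y) = f x * f y].

Definition braid_comm_A (l : nat) (A : algType R) (T : nat -> A) : Prop :=
  (forall i, (0 < i)%N -> (i < l)%N -> T i * T i.+1 * T i = T i.+1 * T i * T i.+1) /\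
  (forall i j, (0 < i <= l)%N -> (0 < j <= l)%N -> (i.+1 < j)%N || (j.+1 < i)%N ->
      T i * T j = T j * T i).

Definition nilcox_rel (l : nat) (A : algType R) (T : nat -> A) : Prop :=
  [/\ braid_comm_A l T & forall i, (0 < i <= l)%N -> T i * T i = 0].

Definition ncA_rel (n d : nat) (A : algType R) (T : nat -> A) : Prop :=
  [/\ braid_comm_A n T,
      forall i, (0 < i < n)%N -> T i * T i = 0 &
      T n ^+ d = 0].

(* generic presentation: (A, T) is the R-algebra presented by generators
   T_1..T_m subject to the relations rel (universal property) *)
Definition presented (m : nat) (rel : forall B : algType R, (nat -> B) -> Prop)
  (A : algType R) (T : nat -> A) : Prop :=
  rel A T /\
  forall (B : algType R) (S : nat -> B), rel B S ->
    (exists f : A -> B, alg_morph f /\ forall i, (0 < i <= m)%N -> f (T i) = S i) /\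
    (forall f g : A -> B, alg_morph f -> alg_morph g ->
       (forall i, (0 < i <= m)%N -> f (T i) = g (T i)) -> forall x, f x = g x).

Definition gen_subalg (l : nat) (A : algType R) (T : nat -> A) (x : A) : Prop :=
  exists (ws : seq (seq nat)) (c : seq R),
     all (all (fun i => 0 < i <= l)%N) ws /\
     x = \sum_(k < size ws) c`_k *: \prod_(i <- nth [::] ws k) T i.

Definition Tw (n : nat) (A : algType R) (T : nat -> A) (w : 'S_n) : A :=
  \prod_(i <- rword w) T i.

(* the claimed basis, indexed by  S_n  +  S_n x [1,d-1] x [1,n]
   (k : 'I_(d-1) stands for k+1, m : 'I_n stands for m+1) :
   T_w   and   T_w T_n^(k+1) T_(n-1) T_(n-2) ... T_(m+1)  *)
Definition ncA_basis (n d : nat) (A : algType R) (T : nat -> A)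
  (b : 'S_n + ('S_n * 'I_(d.-1) * 'I_n)) : A :=
  match b with
  | inl w => Tw T w
  | inr (w, k, m) =>
      Tw T w * T n ^+ k.+1 * \prod_(j <- rev (iota m.+1 (n - m.+1))) T j
  end.

End Alg.

(* Main.v *)
Require Import Defs.
From HB Require Import structures.
From mathcomp Require Import all_boot all_order all_fingroup all_algebra.
From mathcomp Require Import boolp zify.
Set Implicit Arguments. Unset Strict Implicit. Unset Printing Implicit Defensive.
Import GRing.Theory.

(* Left multiplication by a generator sends each claimed basis element to another
   one or to 0.  For [T_i] with [i < n] this is the nil-Coxeter rule
   [T_i T_w = T_(s_i w)] or [0], which rests on Matsumoto's theorem for reduced
   words.  For [T_n], write [w = w' d_p] with [w'] in [S_(n-1)] and
   [d_p = s_(n-1) ... s_p], and put [D_p = T_(n-1) ... T_p]; then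
     [T_n T_w = T_w' T_n D_p],
     [T_n T_w T_n^k D_m = T_w T_n^(k+1) D_m]                 when [p = n],
     [T_n T_w T_n D_m = T_(w' d_(m-1)) T_n D_p]              when [p < n] and [p < m],
   and all other products [T_n T_w T_n^k D_m] vanish.  Hence the claimed elements
   span a left ideal containing [1].  Conversely these formulas define partial maps
   on the set of basis symbols; the partial maps satisfy the defining relations, so
   their 0/1 matrices represent the algebra, and the column of the symbol [1] of the
   matrix of [x] reads off the coordinates of [x].

   The map [NC_A(n,d) -> nilCox(A_l)] killing [T_j] for [j > l] is well defined and
   splits the natural map [nilCox(A_l) -> NC_A(n,d)], which is therefore injective. *)

(** * Permutations and reduced words *)

(** The transposition of [i.-1] and [i] on plain naturals, so that identities between positions
    reduce to case splits and linear arithmetic. *)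
Definition swap (i k : nat) : nat := if k == i then i.-1 else if k == i.-1 then i else k.

Variant swap_spec (i k : nat) : nat -> Type :=
  | SwapR of k = i : swap_spec i k i.-1
  | SwapL of k = i.-1 : swap_spec i k i
  | SwapN of k <> i & k <> i.-1 : swap_spec i k k.

Lemma swapP (i k : nat) : swap_spec i k (swap i k).
Proof. by rewrite /swap; case: eqP => ?; [|case: eqP => ?]; constructor. Qed.

Ltac case_swap :=
  repeat match goal with |- context [swap ?i ?k] =>
    lazymatch k with
    | context [swap _ _] => fail
    | _ => case: (swapP i k) => *; try (exfalso; lia)
    end
  end.

Lemma swap_adjacent i : 0 < i ->
  [/\ swap i i = i.-1, swap i i.-1 = i & swap i i.+1 = i.+1] /\
  [/\ swap i.+1 i = i.+1, swap i.+1 i.-1 = i.-1 & swap i.+1 i.+1 = i].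
Proof. by move=> i0; split; split; case_swap; lia. Qed.

Section Perm.
Variable n : nat.
Implicit Types (w u : 'S_n.+1) (i j k : nat) (s t : seq nat).

Definition wval w k : nat := w (inord k).

(** In a product of permutations the left factor acts first, so [sperm i * w] exchanges the values
    of [w] at positions [i.-1] and [i]. Hence [asc i w] is the condition for left multiplication by
    [s_i] to increase the length. *)
Definition asc i w : bool := wval w i.-1 < wval w i.

Lemma wval_le w k : wval w k <= n.
Proof. by rewrite -ltnS ltn_ord. Qed.

Lemma wval_inj w j k : j <= n -> k <= n -> (wval w j == wval w k) = (j == k).
Proof.
move=> jn kn; apply/eqP/eqP => [/val_inj/perm_inj/(congr1 val)|-> //].
by rewrite /= !inordK.
Qed.

Lemma eq_wval w u : (forall k, k <= n -> wval w k = wval u k) -> w = u.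
Proof.
move=> e; apply/permP => x; apply: val_inj.
by have := e x (ltn_ord x); rewrite /wval inord_val.
Qed.

Lemma wval1 k : k <= n -> wval 1 k = k.
Proof. by move=> kn; rewrite /wval perm1 inordK. Qed.

Lemma spermE i : 0 < i <= n -> sperm n.+1 i = tperm (inord i.-1) (inord i).
Proof.
case/andP=> i0 le_in; rewrite /sperm.
have h : i.-1 < n.+1 by lia.
rewrite (insubT (fun k => k < n.+1) h) (insubT (fun k => k < n.+1) (le_in : i < n.+1)).
by congr tperm; apply: val_inj; rewrite /= inordK.
Qed.

Lemma wval_sperm i k w : 0 < i <= n -> k <= n ->
  wval (sperm n.+1 i * w) k = wval w (swap i k).
Proof.
move=> hi hk; rewrite /wval permM spermE //.
have E a b : a <= n -> b <= n -> ((inord a : 'I_n.+1) == inord b) = (a == b).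
  by move=> ha hb; rewrite -val_eqE /= !inordK.
congr (val (w _)); case: tpermP => [/eqP|/eqP|/eqP + /eqP]; rewrite ?E; try lia.
- by move=> ?; congr inord; case_swap; lia.
- by move=> ?; congr inord; case_swap; lia.
by move=> ? ?; congr inord; case_swap; lia.
Qed.

Lemma swap_le i k : 0 < i <= n -> k <= n -> swap i k <= n.
Proof. by case_swap; lia. Qed.

Lemma spermK i w : 0 < i <= n -> (sperm n.+1 i * (sperm n.+1 i * w))%g = w.
Proof. by move=> hi; rewrite mulgA spermE // tperm2 mul1g. Qed.

Lemma sperm_braid i w : 0 < i < n ->
  (sperm n.+1 i * (sperm n.+1 i.+1 * (sperm n.+1 i * w)))%g =
  (sperm n.+1 i.+1 * (sperm n.+1 i * (sperm n.+1 i.+1 * w)))%g.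
Proof.
move=> hi; apply: eq_wval => k kn.
rewrite !wval_sperm ?swap_le //; try lia; congr (wval w).
by case_swap; lia.
Qed.

Lemma sperm_comm i j w : 0 < i <= n -> 0 < j <= n -> (i.+1 < j) || (j.+1 < i) ->
  (sperm n.+1 i * (sperm n.+1 j * w))%g = (sperm n.+1 j * (sperm n.+1 i * w))%g.
Proof.
move=> hi hj hij; apply: eq_wval => k kn.
rewrite !wval_sperm ?swap_le //; try lia; congr (wval w).
by case_swap; lia.
Qed.

Lemma asc_sperm i w : 0 < i <= n -> asc i (sperm n.+1 i * w) = ~~ asc i w.
Proof.
move=> hi; rewrite /asc !wval_sperm //; try lia.
have -> : swap i i = i.-1 by case_swap; lia.
have -> : swap i i.-1 = i by case_swap; lia.
by have := @wval_inj w i i.-1; lia.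
Qed.

(** Applying [s_i] to both positions matches the inversions of [s_i w] other than [(i-1, i)] with
    those of [w]; the pair [(i-1, i)] is the one new inversion. *)
Lemma perm_length_asc i w : 0 < i <= n -> asc i w ->
  perm_length (sperm n.+1 i * w) = (perm_length w).+1.
Proof.
move=> hi aw; set a : 'I_n.+1 := inord i.-1; set b : 'I_n.+1 := inord i.
have va : val a = i.-1 by rewrite /= inordK; lia.
have vb : val b = i by rewrite /= inordK; lia.
pose f (p : 'I_n.+1 * 'I_n.+1) := (sperm n.+1 i p.1, sperm n.+1 i p.2).
have injf : injective f by move=> [? ?] [? ?] [/perm_inj -> /perm_inj ->].
rewrite /perm_length; set X := [set p | _ & _]; set Y := [set p | _ & _].
rewrite (_ : X = (a, b) |: f @^-1: Y).
  rewrite cardsU1 card_preimset // !inE /f /= spermE // tpermL tpermR.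
  by rewrite va vb (_ : i < i.-1 = false) ?add1n //; lia.
apply/setP => -[x y]; rewrite !inE /= xpair_eqE !permM spermE // -/a -/b.
have ab : (w a : nat) < (w b : nat) by [].
rewrite -!val_eqE /= !va !vb.
by case: (tpermP a b x) => [->|->|/eqP + /eqP]; case: (tpermP a b y) => [->|->|/eqP + /eqP];
  rewrite -?val_eqE /= ?va ?vb; lia.
Qed.

Lemma perm_length_desc i w : 0 < i <= n -> ~~ asc i w ->
  perm_length w = (perm_length (sperm n.+1 i * w)).+1.
Proof. by move=> hi dw; rewrite -(perm_length_asc hi) ?asc_sperm ?spermK. Qed.

Lemma perm_length_spermS i w : 0 < i <= n ->
  perm_length (sperm n.+1 i * w) <= (perm_length w).+1.
Proof.
move=> hi; have [/(perm_length_asc hi) -> //|/(perm_length_desc hi) ->] := boolP (asc i w); lia.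
Qed.

Lemma perm_length1 : perm_length (1%g : 'S_n.+1) = 0.
Proof. by apply: eq_card0 => -[x y]; rewrite !inE !perm1 /=; lia. Qed.

(** Without descents [w] is increasing, so [k <= w k] everywhere; both sides have the same sum over
    all [k], which forces equality. *)
Lemma exists_desc w : w != 1%g -> exists2 i, 0 < i <= n & ~~ asc i w.
Proof.
move=> w1; have [//|no] := pselect (exists2 i, 0 < i <= n & ~~ asc i w).
have incr k : k <= n -> k <= wval w k.
  elim: k => // k IH kn; apply: leq_ltn_trans (IH (ltnW kn)) _.
  by have [//|d] := boolP (asc k.+1 w); case: no; exists k.+1.
have le x : true -> val x <= val (w x) ?= iff (val x == val (w x)).
  by move=> _; split=> //; have := incr x (ltn_ord x); rewrite /wval inord_val.
have [_] := leqif_sum le.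
rewrite [X in _ == X](reindex_inj (@perm_inj _ w^-1)) /=.
under [X in _ == X]eq_bigr do rewrite permKV.
rewrite eqxx => /esym/forallP e; case/eqP: w1; apply/permP => x.
by apply: val_inj; rewrite perm1; have /eqP := e x.
Qed.

Lemma asc_ind (P : 'S_n.+1 -> Prop) : P 1%g ->
  (forall i w, 0 < i <= n -> asc i w -> P w -> P (sperm n.+1 i * w)%g) ->
  forall w, P w.
Proof.
move=> P1 PS w; have [m] := ubnP (perm_length w); elim: m w => // m IH w lw.
have [-> //|/exists_desc [i hi dw]] := eqVneq w 1%g.
rewrite -(spermK w hi); apply: PS; rewrite ?asc_sperm //; apply: IH.
by have := perm_length_desc hi dw; lia.
Qed.

Lemma word_perm_cons i s : word_perm n.+1 (i :: s) = (sperm n.+1 i * word_perm n.+1 s)%g.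
Proof. by rewrite /word_perm big_cons. Qed.

Lemma perm_length_word s : all (fun i => 0 < i < n.+1) s ->
  perm_length (word_perm n.+1 s) <= size s.
Proof.
elim: s => [|i s IH] /=; first by rewrite /word_perm big_nil perm_length1.
case/andP=> hi /IH le; rewrite word_perm_cons.
by have := perm_length_spermS (word_perm n.+1 s) hi; lia.
Qed.

Lemma reduced_word_nil : reduced_word (1%g : 'S_n.+1) [::].
Proof. by rewrite /reduced_word perm_length1 /word_perm big_nil /=. Qed.

(** This turns the definition by length into a recursion on the word: the first letter must be a
    descent, and the tail is reduced for the shorter permutation. *)
Lemma reduced_word_cons w i s : reduced_word w (i :: s) =
  [&& 0 < i <= n, ~~ asc i w & reduced_word (sperm n.+1 i * w) s].
Proof.
rewrite /reduced_word /= -!andbA ltnS; apply/idP/idP.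
  case/and5P=> i0 le_in als /eqP sz /eqP ws; subst w.
  have hi : 0 < i <= n by rewrite i0.
  have ls := perm_length_word als; move: sz.
  rewrite word_perm_cons spermK // i0 le_in als asc_sperm // negbK eqxx andbT /=.
  have [aw|/(perm_length_desc hi)] := boolP (asc i _); last lia.
  by rewrite perm_length_asc // => -[->]; rewrite eqxx.
case/and5P=> i0 le_in dw -> /andP[/eqP -> /eqP ws].
have hi : 0 < i <= n by rewrite i0.
by rewrite i0 le_in -perm_length_desc // word_perm_cons ws spermK // !eqxx.
Qed.

Lemma exists_reduced_word w : exists s, reduced_word w s.
Proof.
elim/asc_ind: w => [|i w hi aw [s rs]]; first by exists [::]; apply: reduced_word_nil.
by exists (i :: s); rewrite reduced_word_cons hi asc_sperm // aw spermK.
Qed.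

Lemma rwordP w : reduced_word w (rword w).
Proof.
have [s rs] := exists_reduced_word w; rewrite /rword.
(* It suffices that the filtered list is nonempty: every reduced word has letters below [n.+1], so
   it is among the enumerated tuples. *)
set l := filter _ _; have : s \in l.
  rewrite mem_filter rs; have /and3P[/allP al /eqP sz _] := rs.
  have sz' : size [seq inord i : 'I_n.+1 | i <- s] == perm_length w.
    by rewrite size_map sz.
  apply/mapP; exists (Tuple sz'); first by rewrite mem_enum.
  rewrite /= -map_comp -[LHS]map_id; apply/eq_in_map => i /al /andP[_ hi].
  by rewrite /= inordK.
have /allP : all (reduced_word w) l by apply: filter_all.
by case: l => //= x l' /(_ x) h _; apply: h; rewrite inE eqxx.
Qed.

End Perm.

(** * Changing the last value of a permutation, and the partial nil-Coxeter action *)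

Section Model.
Variables n d : nat.
Implicit Types (w u : 'S_n.+1) (i j k r : nat).

(* Replaces the last value of [w] by [r], keeping the relative order of the others:
   [w' d_p] becomes [w' d_r], with 0-based [p] and [r]. *)
Definition chg r w : 'S_n.+1 := (w * lift_perm (w (inord n)) (inord r) 1)%g.

Lemma wval_chg_max r w : r <= n -> wval (chg r w) n = r.
Proof. by move=> rn; rewrite /wval permM lift_perm_id inordK. Qed.

Lemma wval_chg r w k : r <= n -> k < n ->
  wval (chg r w) k = bump r (unbump (wval w n) (wval w k)).
Proof.
move=> rn kn; rewrite /wval permM; set q := w (inord n).
have : w (inord k) != q.
  by rewrite (inj_eq perm_inj) -val_eqE /= !inordK; lia.
case: (unliftP q (w (inord k))) => [y ->|-> /eqP //] _.
by rewrite lift_perm_lift perm1 /= bumpK inordK.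
Qed.

Lemma wval_chg_last w k : k < n -> wval (chg n w) k = unbump (wval w n) (wval w k).
Proof.
move=> kn; rewrite wval_chg //.
have : wval w k != wval w n by rewrite wval_inj; lia.
by have := wval_le w k; have := wval_le w n; rewrite /bump /unbump; lia.
Qed.

Lemma chg_id w : chg (wval w n) w = w.
Proof. by rewrite /chg /wval inord_val lift_perm1 mulg1. Qed.

Lemma chg_chg r r' w : chg r (chg r' w) = chg r w.
Proof. by rewrite /chg permM lift_perm_id -mulgA lift_permM mulg1. Qed.

Lemma wval_sperm_max i w : 0 < i < n -> wval (sperm n.+1 i * w) n = wval w n.
Proof. by move=> hi; rewrite wval_sperm; try lia; congr wval; case_swap; lia. Qed.

(** [chg] multiplies on the right and acts on values, while [s_i] acts on positions and, for
    [i < n], leaves the last one alone. *)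
Lemma chg_sperm r i w : 0 < i < n -> (sperm n.+1 i * chg r w)%g = chg r (sperm n.+1 i * w).
Proof.
move=> hi; rewrite /chg mulgA; congr (_ * lift_perm _ _ _)%g.
by apply: val_inj; apply/esym/wval_sperm_max.
Qed.

Lemma asc_chg r i w : r <= n -> 0 < i < n -> asc i (chg r w) = asc i w.
Proof.
move=> rn hi; rewrite /asc !wval_chg; try lia.
have : wval w i != wval w n by rewrite wval_inj; lia.
have : wval w i.-1 != wval w n by rewrite wval_inj; lia.
by rewrite /bump /unbump; lia.
Qed.

(** The nil-Coxeter rule for [T_i T_w], with [None] standing for the product 0. *)
Definition step i w : option 'S_n.+1 := if asc i w then Some (sperm n.+1 i * w)%g else None.

Lemma step_sq i w : 0 < i <= n -> obind (step i) (step i w) = None.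
Proof. by move=> hi; rewrite /step; case: ifP => //= aw; rewrite asc_sperm // aw. Qed.

Lemma step_comm i j w : 0 < i <= n -> 0 < j <= n -> (i.+1 < j) || (j.+1 < i) ->
  obind (step i) (step j w) = obind (step j) (step i w).
Proof.
move=> hi hj hij; rewrite /step.
have a1 : asc i (sperm n.+1 j * w) = asc i w.
  by rewrite /asc !wval_sperm; try lia; congr (wval w _ < wval w _); case_swap; lia.
have a2 : asc j (sperm n.+1 i * w) = asc j w.
  by rewrite /asc !wval_sperm; try lia; congr (wval w _ < wval w _); case_swap; lia.
by case ai: (asc i w); case aj: (asc j w) => //=; rewrite ?a1 ?a2 ?ai ?aj // sperm_comm.
Qed.

(** Both sides test the same three comparisons between the values at [i.-1], [i], [i.+1], in
    opposite orders, so they are defined for the same [w]. *)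
Lemma step_braid i w : 0 < i < n ->
  obind (step i) (obind (step i.+1) (step i w)) =
  obind (step i.+1) (obind (step i) (step i.+1 w)).
Proof.
move=> hi; have [i0 _] := andP hi.
have [[s1 s2 s3] [s4 s5 s6]] := swap_adjacent i0.
have [hi1 hi2] : 0 < i <= n /\ 0 < i.+1 <= n by lia.
have [h0 h1 h2] : [/\ i.-1 <= n, i <= n & i.+1 <= n] by split; lia.
pose a := wval w i.-1; pose b := wval w i; pose c := wval w i.+1.
have A1 : asc i w = (a < b) by [].
have B1 : asc i.+1 w = (b < c) by [].
have A2 : asc i.+1 (sperm n.+1 i * w) = (a < c) by rewrite /asc !wval_sperm // s1 s3.
have B2 : asc i (sperm n.+1 i.+1 * w) = (a < c) by rewrite /asc !wval_sperm // s4 s5.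
have A3 : asc i (sperm n.+1 i.+1 * (sperm n.+1 i * w)) = (b < c).
  by rewrite /asc !wval_sperm ?s4 ?s5 // s2 s3.
have B3 : asc i.+1 (sperm n.+1 i * (sperm n.+1 i.+1 * w)) = (a < b).
  by rewrite /asc !wval_sperm ?s1 ?s3 // s5 s6.
rewrite /step A1 B1.
case ab: (a < b); case bc: (b < c); case ac: (a < c);
  by rewrite /= ?A2 ?B2 ?ac /= ?A3 ?B3 ?ab ?bc //= sperm_braid.
Qed.

(** * The action on basis symbols *)

(* A basis symbol [inr (w, k, m)] stands for [T_w T_n^(k+1) T_(n-1) ... T_(m+1)],
   where the paper's [n] is [n.+1] here and its [d] is [d.+2]. *)
Definition bsym : Type := ('S_n.+1 + 'S_n.+1 * 'I_d.+1 * 'I_n.+1)%type.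
Implicit Types b : bsym.

Definition sym_perm b : 'S_n.+1 := match b with inl w => w | inr (w, _, _) => w end.

Definition set_perm b w : bsym :=
  match b with inl _ => inl w | inr (_, k, m) => inr (w, k, m) end.

(** The rules for left multiplication by the last generator, with [wval w n] as the 0-based [p].
    [insub] fails exactly when the exponent would reach [d.+2]. In the last rule [wval w n < m]
    makes [m] positive, so [m.-1] is a true predecessor. *)
Definition sact_last b : option bsym :=
  match b with
  | inl w => Some (inr (chg n w, ord0, inord (wval w n)))
  | inr (w, k, m) =>
      if wval w n == n then omap (fun k' : 'I_d.+1 => inr (w, k', m)) (insub k.+1)
      else if (k == 0 :> nat) && (wval w n < m)
      then Some (inr (chg m.-1 w, k, inord (wval w n))) else None
  end.

Definition sact i b : option bsym :=
  if i <= n then omap (set_perm b) (step i (sym_perm b)) else sact_last b.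

Lemma obind_sact_set i b o : i <= n ->
  obind (sact i) (omap (set_perm b) o) = omap (set_perm b) (obind (step i) o).
Proof.
move=> hi; case: o => //= w; rewrite /sact hi.
by case: b => [u|[[u k] m]] /=; case: step.
Qed.

Lemma sact_low i b : i <= n -> sact i b = omap (set_perm b) (step i (sym_perm b)).
Proof. by rewrite /sact => ->. Qed.

Lemma sact_sq i b : 0 < i <= n -> obind (sact i) (sact i b) = None.
Proof.
by move=> hi; have [_ le_in] := andP hi; rewrite sact_low // obind_sact_set // step_sq.
Qed.

Lemma sact_comm_low i j b : 0 < i <= n -> 0 < j <= n -> (i.+1 < j) || (j.+1 < i) ->
  obind (sact i) (sact j b) = obind (sact j) (sact i b).
Proof.
move=> hi hj hij; have [[_ le_in] [_ le_jn]] := (andP hi, andP hj).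
by rewrite !sact_low // !obind_sact_set // step_comm.
Qed.

Lemma sact_braid_low i b : 0 < i < n ->
  obind (sact i) (obind (sact i.+1) (sact i b)) =
  obind (sact i.+1) (obind (sact i) (sact i.+1 b)).
Proof.
by move=> hi; rewrite !sact_low ?obind_sact_set ?step_braid //; lia.
Qed.

(** The rules in [sact_last] see [w] only through its last value and through [chg], and both are
    compatible with [s_i] for [i < n]. *)
Lemma sact_comm_last i b : 0 < i < n ->
  obind (sact i) (sact n.+1 b) = obind (sact n.+1) (sact i b).
Proof.
move=> hi; rewrite /sact ltnn (_ : i <= n); last lia.
rewrite /step; case: b => [w|[[w k] m]] /=.
  rewrite asc_chg //; case: ifP => //= aw.
  by rewrite chg_sperm // wval_sperm_max.
case: ifP => [/eqP qn|qn]; last case: ifP => [/andP[k0 qm]|km] /=.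
- case ai: (asc i w) => /=; first rewrite wval_sperm_max // qn eqxx;
    by case: (insub k.+1 : option 'I_d.+1) => //= k'; rewrite ai.
- rewrite asc_chg //; last by have := ltn_ord m; lia.
  case: ifP => //= aw; rewrite wval_sperm_max // qn k0 qm /=.
  by rewrite chg_sperm.
- by case: ifP => //= aw; rewrite wval_sperm_max // qn km.
Qed.

Lemma eq_wval_last w u : 0 < n -> wval w n = wval u n -> wval w n.-1 = wval u n.-1 ->
  (forall k, k < n.-1 -> wval w k = wval u k) -> w = u.
Proof.
move=> n0 e1 e2 e3; apply: eq_wval => k kn.
have [/e3 //|k1] := ltnP k n.-1.
by have [->|kn'] := eqVneq k n; rewrite // (_ : k = n.-1) //; lia.
Qed.

(** With [a] and [q] the last two values of [w], both sides are defined under the same condition: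
    [a < q] for [inl], and [a < q < m] with [k = 0] for [inr]. The resulting permutations are then
    compared at position [n], at [n.-1], and at the remaining ones. *)
Lemma sact_braid_last b : 0 < n ->
  obind (sact n) (obind (sact n.+1) (sact n b)) =
  obind (sact n.+1) (obind (sact n) (sact n.+1 b)).
Proof.
move=> n0; have hn : 0 < n <= n by rewrite n0 leqnn.
have n1 : n.-1 < n by lia.
have sl u : wval (sperm n.+1 n * u) n = wval u n.-1.
  by rewrite wval_sperm //; congr wval; case_swap; lia.
have sp u : wval (sperm n.+1 n * u) n.-1 = wval u n.
  by rewrite wval_sperm //; [congr wval; case_swap; lia | lia].
have so u k : k < n.-1 -> wval (sperm n.+1 n * u) k = wval u k.
  by move=> hk; rewrite wval_sperm //; [congr wval; case_swap; lia | lia].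
have wne u k : k < n.-1 -> wval u k != wval u n.-1 /\ wval u k != wval u n.
  by move=> hk; rewrite !wval_inj; lia.
have wle u k := wval_le u k.
have ltn k : k < n.-1 -> k < n by lia.
rewrite /sact leqnn ltnn /step /asc; case: b => [w|[[w k] m]] /=.
  have anq : wval w n.-1 != wval w n by rewrite wval_inj; lia.
  have [la lq] := (wle w n.-1, wle w n).
  have b1 := wval_chg_last w n1.
  rewrite wval_chg_max // b1 (_ : unbump _ _ < n) /=; last by rewrite /unbump; lia.
  rewrite sl b1 inordK // (_ : unbump _ _ == n = false); last by rewrite /unbump; lia.
  rewrite (_ : (unbump _ _ < _) = (wval w n.-1 < wval w n)); last by rewrite /unbump; lia.
  case: ifP => //= aq.
  rewrite wval_chg_max // wval_chg_last // sl sp (_ : unbump _ _ < n); last by rewrite /unbump; lia.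
  congr (Some (inr (_, _, _))); last by congr inord; rewrite /unbump; lia.
  have lq1 : (wval w n).-1 <= n by lia.
  apply: eq_wval_last => // [||j hj].
  - by rewrite sl wval_chg_last // sl sp wval_chg_max // /unbump; lia.
  - by rewrite sp wval_chg_max // wval_chg // sl sp wval_chg_max // b1 /bump /unbump; lia.
  have lj := ltn _ hj; have [v1 v2] := wne w j hj; have lv := wle w j.
  rewrite so // wval_chg_last // wval_chg // !sl !so // b1 wval_chg_last // /bump /unbump.
  move: v1 v2 lv anq la lq aq {b1 lq1}.
  by move: (wval w j) (wval w n) (wval w n.-1) => v q a; lia.
pose a := wval w n.-1; pose q := wval w n; rewrite -/a -/q.
have anq : a != q by rewrite wval_inj; lia.
have [la lq] : a <= n /\ q <= n by split; apply: wle.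
have lm : m <= n by rewrite -ltnS.
have lm1 : m.-1 <= n by lia.
have lq1 : q.-1 <= n by lia.
have c1 : wval (chg m.-1 w) n.-1 = bump m.-1 (unbump q a) by rewrite wval_chg.
have c2 : wval (chg m.-1 (sperm n.+1 n * w)) n.-1 = bump m.-1 (unbump a q).
  by rewrite wval_chg // sl sp.
(* If this condition fails, some factor along either route gives [None]; this is settled first. *)
have [C|C] := boolP [&& a < q, k == 0 :> nat & q < m]; last first.
  transitivity (@None bsym).
    case: ifP => //= aq; rewrite sl -/a (_ : a == n = false); last lia.
    case: ifP => //= km; rewrite c2 wval_chg_max //.
    by rewrite (_ : bump _ _ < _ = false) //= /bump /unbump; lia.
  case: ifP => [qn|qn].
    case: insubP => //= k' _ vk'; rewrite -/a -/q (_ : a < q) /=; last lia.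
    by rewrite sl -/a (_ : a == n = false) ?vk' //; lia.
  case: ifP => //= km; rewrite c1 wval_chg_max //.
  case: ifP => //= am; rewrite sl c1 inordK //.
  rewrite (_ : bump _ _ == n = false); last lia.
  by rewrite (_ : bump _ _ < q = false) ?andbF //; move: am; rewrite /bump /unbump; lia.
have /and3P[aq k0 qm] := C.
rewrite aq /= sl -/a (_ : a == n = false); last lia.
rewrite k0 (_ : a < m) /=; last lia.
rewrite c2 wval_chg_max // (_ : bump _ _ < _); last by rewrite /bump /unbump; lia.
rewrite (_ : q == n = false) ?qm /=; last lia.
rewrite c1 wval_chg_max // (_ : bump _ _ < _) /=; last by rewrite /bump /unbump; lia.
rewrite sl c1 inordK // (_ : bump _ _ == n = false); last by rewrite /bump /unbump; lia.
rewrite k0 (_ : bump _ _ < q) /=; last by rewrite /bump /unbump; lia.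
congr (Some (inr (_, _, _))); last by congr inord; rewrite /bump /unbump; lia.
apply: eq_wval_last => // [||j hj].
- by rewrite sl c2 wval_chg_max // /bump /unbump; lia.
- by rewrite sp wval_chg_max // wval_chg // sl sp c1 wval_chg_max // /bump /unbump; lia.
have lj := ltn _ hj; have [v1 v2] := wne w j hj; have lv := wle w j.
rewrite so // !wval_chg // !sl !so // c1 wval_chg // -/a -/q.
move: v1 v2 lv lm aq qm {c1 c2 C}; rewrite /a /q.
move: (wval w j) (wval w n.-1) (wval w n) (m : nat) => v a' q' m'.
by clear; rewrite /bump /unbump; lia.
Qed.

Lemma sact_last_nilp b : iter d.+2 (obind sact_last) (Some b) = None.
Proof.
(* Once [w] fixes [n], every application only raises the exponent, until it overflows. *)
have fixed w (k : 'I_d.+1) m j : wval w n = n -> d < k + j ->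
    iter j (obind sact_last) (Some (inr (w, k, m))) = None.
  move=> wn; elim: j k => [|j IH] k kj; first by have := ltn_ord k; lia.
  rewrite iterSr /= wn eqxx; case: insubP => [k' _ vk'|_] /=; last by elim: j {IH kj} => //= j ->.
  by rewrite IH // vk'; lia.
have none j : iter j (obind sact_last) None = None by elim: j => //= j ->.
case: b => [w|[[w k] m]]; rewrite iterSr.
  by apply: fixed; rewrite ?wval_chg_max //= addSn.
have [wn|wn] := eqVneq (wval w n) n.
  by rewrite -iterSr fixed //; lia.
(* If [w] moves [n], two applications already give [None]: after the first, the last value is [m.-1]
   and the new index is the old last value [q <= m.-1], so the required strict inequality fails. *)
rewrite iterSr /= (negbTE wn); case: ifP => [/andP[k0 qm]|_] /=; last by rewrite none.
have lm := ltn_ord m.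
rewrite wval_chg_max ?inordK ?ltnS ?wval_le //; last lia.
rewrite (_ : m.-1 == n = false); last lia.
by rewrite (_ : m.-1 < wval w n = false) ?andbF ?none //; lia.
Qed.

End Model.

(** * Multiplication of the basis elements by generators *)

Local Open Scope ring_scope.

Lemma rev_iotaS a c : rev (iota a c.+1) = (a + c)%N :: rev (iota a c).
Proof. by rewrite -addn1 iotaD cats1 rev_rcons. Qed.

(** * Permutations fixing the last point and their coset representatives *)

Section FixedLast.
Variable n : nat.
Implicit Types (w : 'S_n.+1) (q : nat).

Lemma asc_ind_fixed (P : 'S_n.+1 -> Prop) : P 1%g ->
  (forall i w, (0 < i < n)%N -> asc i w -> wval w n = n -> P w -> P (sperm n.+1 i * w)%g) ->
  forall w, wval w n = n -> P w.
Proof.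
move=> P1 PS; elim/asc_ind => // i w hi aw IH wn.
have hin : (0 < i < n)%N.
  (* The letter [n] cannot occur: it would need value [n] at position [n.-1] below a larger last
     value. *)
  have [e|] := eqVneq i n; last lia.
  move: wn aw; rewrite e in hi *.
  rewrite wval_sperm // (_ : swap n n = n.-1); last by case_swap; lia.
  by rewrite /asc => ->; have := wval_le w n; lia.
rewrite wval_sperm_max // in wn.
by apply: PS => //; apply: IH.
Qed.

(** The word [q+c, ..., q+1] is built from its right end; each new letter exchanges the value [q]
    with a larger fixed point to its right, hence is an ascent. *)
Lemma reduced_down q c : (q + c <= n)%N ->
  let s := rev (iota q.+1 c) in
  reduced_word (word_perm n.+1 s) s /\
  forall k, (k <= n)%N ->
    wval (word_perm n.+1 s) k = if k == (q + c)%N then q else (k + (q <= k < q + c))%N.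
Proof.
elim: c => [|c IH] qc s; rewrite {}/s.
  rewrite /rev /= /word_perm big_nil; split=> [|k kn]; first exact: reduced_word_nil.
  by rewrite wval1 //; case: eqP; lia.
have [|rs vs] := IH; first by lia.
rewrite rev_iotaS word_perm_cons addSn.
set s := rev (iota q.+1 c) in rs vs *; set u := word_perm _ _ in rs vs *.
have hi : (0 < (q + c).+1 <= n)%N by lia.
split=> [|k kn].
  rewrite reduced_word_cons hi asc_sperm // spermK // rs andbT /= negbK /asc.
  rewrite !vs //; try lia.
  by rewrite /= eqxx; case: eqP; lia.
rewrite wval_sperm // vs ?swap_le //.
by case: swapP => *; case: eqP => ?; case: eqP => ?; lia.
Qed.

Lemma reduced_chg q : (q <= n)%N -> reduced_word (chg q (1%g : 'S_n.+1)) (rev (iota q.+1 (n - q))).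
Proof.
move=> qn; have [|rs vs] := @reduced_down q (n - q); first by lia.
suff -> : chg q 1 = word_perm n.+1 (rev (iota q.+1 (n - q))) by [].
apply: eq_wval => k kn; rewrite vs //; case: eqP => [->|kq].
  by rewrite subnKC // wval_chg_max.
by rewrite wval_chg ?wval1 // /bump /unbump; lia.
Qed.

End FixedLast.

(** * Matsumoto's theorem and the nil-Coxeter multiplication rule *)

Section Matsumoto.
Variables (R : comPzRingType) (n : nat) (A : algType R) (T : nat -> A).

(** Induction on the length. When the first letters [i] and [j] differ, both are descents, so [w]
    also has reduced words starting with the two sides of the commutation or braid relation between
    them; the induction hypothesis applies to the tails. *)
Lemma matsumoto (w : 'S_n.+1) s t : braid_comm_A n T ->
  reduced_word w s -> reduced_word w t -> \prod_(i <- s) T i = \prod_(i <- t) T i.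
Proof.
move=> [braid comm]; have [m] := ubnP (perm_length w).
elim: m w s t => // m IH w s t lw rs rt.
have size_red r : reduced_word w r -> size r = perm_length w by case/and3P=> _ /eqP.
case: s t rs rt => [|i s] [|j t] // rs rt.
- by have := size_red _ rs; rewrite -(size_red _ rt).
- by have := size_red _ rs; rewrite -(size_red _ rt).
wlog ij : i j s t rs rt / (i <= j)%N.
  by move=> H; have [/H|/ltnW/H] := leqP i j; [apply|move=> e; apply/esym/e].
move: rs rt; rewrite !reduced_word_cons !big_cons => /and3P[hi di rs] /and3P[hj dj rt].
have li := perm_length_desc hi di; have lj := perm_length_desc hj dj.
have IHi r : reduced_word (sperm n.+1 i * w)%g r -> \prod_(i <- s) T i = \prod_(i <- r) T i.
  by apply: IH rs; lia.
have IHj r : reduced_word (sperm n.+1 j * w)%g r -> \prod_(i <- t) T i = \prod_(i <- r) T i.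
  by apply: IH rt; lia.
have [eij|nij] := eqVneq i j.
  by rewrite eij in IHi *; rewrite (IHi t).
move: di dj; rewrite /asc -!leqNgt => di dj.
have [e|far] := eqVneq j i.+1; last first.
  have [r rr] := exists_reduced_word (sperm n.+1 i * (sperm n.+1 j * w)).
  rewrite (IHi (j :: r)); last first.
    rewrite reduced_word_cons hj -sperm_comm ?rr ?andbT //=; last lia.
    by rewrite /asc !wval_sperm; try lia; rewrite -leqNgt;
       move: dj; congr (wval w _ <= wval w _)%N; case_swap; lia.
  rewrite (IHj (i :: r)); last first.
    rewrite reduced_word_cons hi rr ?andbT //=.
    by rewrite /asc !wval_sperm; try lia; rewrite -leqNgt;
       move: di; congr (wval w _ <= wval w _)%N; case_swap; lia.
  by rewrite !big_cons !mulrA comm //; lia.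
subst j; rewrite /= in dj; have hii : (0 < i < n)%N by lia.
(* Descents at [i] and [i.+1] mean that the three values decrease, so the longest element of this
   copy of [S_3] can be split off on the left. *)
have [r rr] := exists_reduced_word (sperm n.+1 i * (sperm n.+1 i.+1 * (sperm n.+1 i * w))).
have [i0 _] := andP hi; have [[s1 s2 s3] [s4 s5 s6]] := swap_adjacent i0.
have [h0 h1 h2] : [/\ i.-1 <= n, i <= n & i.+1 <= n]%N by split; lia.
rewrite (IHi [:: i.+1, i & r]); last first.
  rewrite !reduced_word_cons hi hj rr !andbT /=.
  by rewrite /asc !wval_sperm ?s1 ?s2 ?s3 ?s4 ?s5 ?s6 //= ?s2 ?s3 ?s5 ?s6; lia.
rewrite (IHj [:: i, i.+1 & r]); last first.
  rewrite !reduced_word_cons hi hj -sperm_braid // rr !andbT /=.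
  by rewrite /asc !wval_sperm ?s1 ?s2 ?s3 ?s4 ?s5 ?s6 //= ?s2 ?s3 ?s5 ?s6; lia.
by rewrite !big_cons !mulrA braid //; lia.
Qed.

Lemma Tw_reduced (w : 'S_n.+1) s : braid_comm_A n T -> reduced_word w s ->
  Tw T w = \prod_(i <- s) T i.
Proof. by move=> bc; apply: matsumoto (rwordP w). Qed.

Lemma Tw1 : braid_comm_A n T -> Tw T (1%g : 'S_n.+1) = 1.
Proof. by move=> bc; rewrite (Tw_reduced bc (reduced_word_nil n)) big_nil. Qed.

Lemma mul_Tw_asc i (w : 'S_n.+1) : braid_comm_A n T -> (0 < i <= n)%N -> asc i w ->
  T i * Tw T w = Tw T (sperm n.+1 i * w)%g.
Proof.
move=> bc hi aw; rewrite [RHS](@Tw_reduced _ (i :: rword w)) ?big_cons //.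
by rewrite reduced_word_cons hi asc_sperm // aw spermK // rwordP.
Qed.

Lemma mul_Tw i (w : 'S_n.+1) : nilcox_rel n T -> (0 < i <= n)%N ->
  T i * Tw T w = if asc i w then Tw T (sperm n.+1 i * w)%g else 0.
Proof.
move=> [bc sq] hi; case: ifP => [|/negbT dw]; first exact: mul_Tw_asc.
by rewrite -{1}(spermK w hi) -mul_Tw_asc ?asc_sperm // mulrA sq // mul0r.
Qed.

End Matsumoto.

(** * Decreasing products of generators *)

Section Down.
Variables (R : comPzRingType) (A : algType R) (T : nat -> A).

(** This is [T_(a+c-1) ... T_a]; the factor [D] attached to a 0-based index [m] is
    [down m.+1 (n - m)]. *)
Definition down a c : A := \prod_(j <- rev (iota a c)) T j.

Lemma down0 a : down a 0 = 1.
Proof. by rewrite /down big_nil. Qed.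

Lemma downSl a c : down a c.+1 = T (a + c)%N * down a c.
Proof. by rewrite /down rev_iotaS big_cons. Qed.

Lemma downD a c c' : down a (c + c') = down (a + c) c' * down a c.
Proof. by rewrite /down iotaD rev_cat big_cat. Qed.

Lemma downSr a c : down a c.+1 = down a.+1 c * T a.
Proof. by rewrite -add1n downD addn1 (downSl a 0) down0 mulr1 addn0. Qed.

Variable N : nat.
Hypothesis bc : braid_comm_A N T.

Lemma down_comm i a c : (0 < i <= N)%N -> (0 < a)%N -> (a + c <= N.+1)%N ->
  (i.+1 < a)%N || (a + c < i)%N -> T i * down a c = down a c * T i.
Proof.
have [_ comm] := bc.
move=> hi a0; elim: c => [|c IH] hc far; first by rewrite down0 mulr1 mul1r.
by rewrite downSl mulrA comm ?[in RHS]mulrA -?mulrA ?IH //; lia.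
Qed.

Lemma down_shift a c j : (0 < a < j)%N -> (j < a + c <= N.+1)%N ->
  down a c * T j = T j.-1 * down a c.
Proof.
have [braid _] := bc; move=> hj hc.
(* The product is cut as [X T_j T_(j-1) Y], where [X] commutes with [T_(j-1)] and [Y] with [T_j];
   the braid relation then does the rest. *)
have -> : c = ((j.-1 - a) + (1 + (1 + (a + c - j.+1))))%N by lia.
rewrite 3!downD !subnKC; try lia.
rewrite -[down _ 1]/(down _ 0.+1) -[down (j.-1 + 1) 1]/(down _ 0.+1) !downSl !down0 !mulr1 !addn0.
have -> : (j.-1 + 1 = j)%N by lia.
set X := down (j + 1) _; set Y := down a _.
have XT : T j.-1 * X = X * T j.-1 by apply: down_comm; lia.
have YT : T j * Y = Y * T j by apply: down_comm; lia.
have jj : j.-1.+1 = j by lia.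
have B := braid j.-1; rewrite jj in B.
by rewrite -!mulrA -YT !mulrA XT -!mulrA (mulrA (T j)) (mulrA (T j * _)) -B ?mulrA //; lia.
Qed.

Lemma down_down_shift q e m c : (q < m)%N -> (m + c <= q + e)%N -> (q + e <= N)%N ->
  down q.+1 e * down m.+1 c = down m c * down q.+1 e.
Proof.
move=> qm; elim: c => [|c IH] hc hN; first by rewrite !down0 mulr1 mul1r.
rewrite !downSl mulrA down_shift; try lia.
by rewrite -!mulrA IH //; lia.
Qed.

(** The factors of the second product above index [q+1] move left past the first product with index
    lowered by one; the first product, which ends in [T_(q+1)], then meets [T_(q+1)]. *)
Lemma down_down0 q m : (m <= q < N)%N -> (forall i, (0 < i <= N)%N -> T i * T i = 0) ->
  down q.+1 (N - q) * down m.+1 (N - m) = 0.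
Proof.
move=> mq sq; have -> : (N - m = (q - m) + (1 + (N - q.+1)))%N by lia.
rewrite !downD -[down _ 1]/(down _ 0.+1) downSl down0 mulr1 addn0.
have -> : (m.+1 + (q - m) = q.+1)%N by lia.
rewrite addn1 mulrA mulrA down_down_shift; try lia.
have -> : (N - q = (N - q.+1).+1)%N by lia.
by rewrite downSr -!mulrA (mulrA (T _)) sq ?mul0r ?mulr0 //; lia.
Qed.

End Down.

(** * The multiplication rules in the presented algebra *)

Section Span.
Variables (R : comPzRingType) (n d : nat) (A : algType R) (T : nat -> A).
Hypothesis rel : ncA_rel n.+1 d.+2 T.
Implicit Types (w : 'S_n.+1).

Lemma ncA_braid_comm_low : braid_comm_A n T.
Proof.
by have [[braid comm] _ _] := rel; split=> [i ? ?|i j ? ? ?]; [apply: braid|apply: comm]; lia.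
Qed.

Lemma ncA_nilcox_low : nilcox_rel n T.
Proof.
by have [_ sq _] := rel; split=> [|i ?]; [apply: ncA_braid_comm_low|apply: sq].
Qed.

Let bc := ncA_braid_comm_low.
Let nc := ncA_nilcox_low.

Lemma Tw_fixed_comm w : wval w n = n -> Tw T w * T n.+1 = T n.+1 * Tw T w.
Proof.
have [[_ comm] _ _] := rel.
elim/asc_ind_fixed => [|i u hi au _ IH]; first by rewrite Tw1 // mulr1 mul1r.
rewrite -mul_Tw_asc //; last lia.
by rewrite -mulrA IH !mulrA comm //; lia.
Qed.

(** Lengths add in [w d_q] when [w] fixes the last point: letters [i < n] are ascents of [chg q u]
    exactly when they are ascents of [u]. *)
Lemma Tw_chg w q : wval w n = n -> (q <= n)%N ->
  Tw T (chg q w) = Tw T w * down T q.+1 (n - q).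
Proof.
move=> + qn; elim/asc_ind_fixed => [|i u hi au _ IH].
  by rewrite (Tw_reduced bc (reduced_chg qn)) Tw1 // mul1r.
rewrite -chg_sperm // -!mul_Tw_asc // ?asc_chg //; try lia.
by rewrite IH mulrA.
Qed.

Lemma Tw_decomp w : Tw T w = Tw T (chg n w) * down T (wval w n).+1 (n - wval w n).
Proof.
by rewrite -{1}(chg_id w) -{1}(chg_chg _ n) Tw_chg ?wval_chg_max ?wval_le.
Qed.

Lemma last_down_last q k m : (q < n)%N -> (m <= n)%N ->
  T n.+1 * down T q.+1 (n - q) * T n.+1 ^+ k.+1 * down T m.+1 (n - m) =
  if (k == 0%N) && (q < m)%N
  then down T m (n.+1 - m) * T n.+1 * down T q.+1 (n - q) else 0.
Proof.
move=> qn mn; have [bcS sq _] := rel; have [braid _] := bcS.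
have e : (n - q = (n - q.+1).+1)%N by lia.
have f : (q.+1 + (n - q.+1) = n)%N by lia.
set E := down T q.+1 (n - q.+1).
have DE : down T q.+1 (n - q) = T n * E by rewrite e downSl f.
have ET : T n.+1 * E = E * T n.+1 by apply: (down_comm bcS); lia.
have br : T n.+1 * T n * T n.+1 = T n * T n.+1 * T n by rewrite braid //; lia.
have sqn : T n * T n = 0 by apply: sq; lia.
(* This form can be iterated: a second factor [T_(n+1)] on the right produces [T_n T_n = 0], which
   settles exponents above 1. *)
have main : T n.+1 * down T q.+1 (n - q) * T n.+1 = T n * T n.+1 * down T q.+1 (n - q).
  by rewrite DE -!mulrA -ET !mulrA br.
case: k => [|k] /=; last first.
  rewrite !exprS !mulrA main -(mulrA (T n)) -(mulrA (T n)) main !mulrA sqn.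
  by rewrite !mul0r.
rewrite expr1 main -(mulrA (T n * _)); case: ltnP => [qm|mq]; last first.
  by rewrite (down_down0 bc) ?mulr0 ?mq //; have [] := nc.
rewrite (down_down_shift bc) //; try lia.
rewrite mulrA -(mulrA (T n)) (down_comm bcS); try lia.
rewrite !mulrA; congr (_ * _ * _).
have -> : (n.+1 - m = (n - m).+1)%N by lia.
by rewrite downSl subnKC.
Qed.

Lemma ncA_basis_inr w (k : 'I_d.+1) (m : 'I_n.+1) :
  @ncA_basis R n.+1 d.+2 A T (inr (w, k, m)) =
  Tw T w * T n.+1 ^+ k.+1 * down T m.+1 (n - m).
Proof. by []. Qed.

Lemma mul_ncA_basis i (b : bsym n d) : (0 < i <= n.+1)%N ->
  T i * @ncA_basis R n.+1 d.+2 A T b = oapp (@ncA_basis R n.+1 d.+2 A T) 0 (sact i b).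
Proof.
move=> hi; rewrite /sact; case: leqP => [le_in|lt_ni].
  case: b => [w|[[w k] m]]; rewrite ?ncA_basis_inr /step /= ?mulrA mul_Tw //; try lia.
    by case: ifP.
  by case: ifP => _; rewrite /= ?mul0r.
have {hi lt_ni} -> : i = n.+1 by lia.
case: b => [w|[[w k] m]] /=.
  have cn : wval (chg n w) n = n by rewrite wval_chg_max.
  by rewrite [in LHS]Tw_decomp mulrA -Tw_fixed_comm // inordK // ltnS wval_le.
rewrite -/(down T m.+1 (n - m)); case: eqP => [wn|wn].
  rewrite !mulrA -Tw_fixed_comm // -(mulrA (Tw T w)) -exprS.
  case: insubP => [k' _ vk' /=|dk /=]; first by rewrite vk'.
  have [_ _ nilp] := rel.
  (* [insub] failed, so the exponent has reached [d.+2]. *)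
  have -> : (k.+2 = d.+2 + (k - d))%N by have := ltn_ord k; lia.
  by rewrite exprD nilp mul0r mulr0 mul0r.
have qn : (wval w n < n)%N by have := wval_le w n; lia.
have mn : (m <= n)%N by rewrite -ltnS.
have cn : wval (chg n w) n = n by rewrite wval_chg_max.
rewrite Tw_decomp !mulrA -Tw_fixed_comm // -!mulrA (mulrA (down _ _ _)) mulrA -mulrA.
rewrite (mulrA (T n.+1)) (mulrA (T n.+1)) last_down_last //.
case: ifP => [/andP[/eqP k0 qm]|_] /=; last by rewrite mulr0.
rewrite k0 expr1 inordK ?ltnS ?wval_le //.
rewrite -(chg_chg m.-1 n w) [in RHS](Tw_chg cn); last lia.
have -> : m.-1.+1 = m by lia.
have -> : (n - m.-1 = n.+1 - m)%N by lia.
by rewrite !mulrA.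
Qed.

End Span.

(** * The matrix representation *)

Section Run.
Variables n d : nat.
Implicit Types (w : 'S_n.+1) (b : bsym n d).

Definition run (s : seq nat) (o : option (bsym n d)) := foldr (fun i => obind (sact i)) o s.

Lemma run_cat s t o : run (s ++ t) o = run s (run t o).
Proof. by rewrite /run foldr_cat. Qed.

Lemma run_reduced w s b : reduced_word w s -> sym_perm b = 1%g ->
  run s (Some b) = Some (set_perm b w).
Proof.
move=> + b1; elim: s w => [|i s IH] w /=.
  case/and3P=> _ _; rewrite /word_perm big_nil => /eqP <-.
  by case: b b1 => [?|[[? ?] ?]] /= ->.
rewrite reduced_word_cons => /and3P[hi dw /IH ->] /=.
rewrite sact_low; last lia.
have -> : sym_perm (set_perm b (sperm n.+1 i * w)) = (sperm n.+1 i * w)%g.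
  by case: b {b1 IH} => [?|[[? ?] ?]].
rewrite /step asc_sperm // dw /= spermK //.
by case: b {b1 IH} => [?|[[? ?] ?]].
Qed.

Definition basis_word b : seq nat :=
  match b with
  | inl w => rword w
  | inr (w, k, m) => rword w ++ nseq k.+1 n.+1 ++ rev (iota m.+1 (n - m))
  end.

Lemma basis_word_letters b : all (fun i => 0 < i <= n.+1)%N (basis_word b).
Proof.
have rw (w : 'S_n.+1) : all (fun i => 0 < i <= n.+1)%N (rword w).
  have /and3P[aw _ _] := rwordP w.
  by apply: sub_all aw => i /andP[-> /ltnW].
case: b => [w|[[w k] m]]; first exact: rw.
rewrite /basis_word !all_cat rw all_nseq ltn0Sn leqnn orbT all_rev /=.
by apply/allP => i; rewrite mem_iota; lia.
Qed.

(** This makes the matrix of a basis element send the symbol of 1 to that element's own symbol, from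
    which independence follows. *)
Lemma run_basis_word b : run (basis_word b) (Some (inl 1%g)) = Some b.
Proof.
case: b => [w|[[w k] m]]; first by rewrite (run_reduced (rwordP w)).
have mn : (m <= n)%N by rewrite -ltnS.
rewrite /basis_word !run_cat (run_reduced (reduced_chg mn)) //.
(* The first [T_(n+1)] turns [inl (chg m 1)] into [inr (1, 0, m)]; each further one raises the
   exponent. *)
have -> : run (nseq k.+1 n.+1) (Some (set_perm (inl 1%g) (chg m 1))) = Some (inr (1%g, k, m)).
  case: k => k hk; elim: k hk => [|k IH] hk.
    rewrite /= /sact ltnn /= wval_chg_max // inord_val chg_chg.
    have -> : chg n 1%g = 1%g :> 'S_n.+1 by have := chg_id (1%g : 'S_n.+1); rewrite wval1.
    congr (Some (inr (_, _, _))); exact: val_inj.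
  rewrite -[nseq k.+2 _]/(n.+1 :: nseq k.+1 n.+1) -cat1s run_cat IH; first lia.
  move=> hk'; rewrite /= /sact ltnn /= wval1 // eqxx insubT.
  by congr (Some (inr (_, _, _))); apply: val_inj.
by rewrite (run_reduced (rwordP w)).
Qed.

End Run.

(** * Matrices of partial maps *)

Section PartialMapMatrix.
Variables (R : comPzRingType) (nzR : (1 : R) != 0).

Let R' : comNzRingType :=
  HB.pack (GRing.ComPzRing.sort R)
    (GRing.PzSemiRing_isNonZero.Build (GRing.ComPzRing.sort R) nzR).

(* [algType] demands a nontrivial ring, so matrices over [R] form an [algType R]
   only once [1 != 0] in [R] is known. *)
Definition mxalg N : algType R := ('M[R']_N.+1 : algType R').

Variables (I : finType) (N : nat) (e : 'I_N.+1 -> I) (e' : I -> 'I_N.+1).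
Hypotheses (eK : cancel e e') (e'K : cancel e' e).
Implicit Types f g : I -> option I.

(** Column [j] marks the image of [e j] and is zero for [None], so composition of partial maps
    becomes the matrix product. *)
Definition pmx f : mxalg N := \matrix_(i, j) (f (e j) == Some (e i))%:R : 'M[R]_N.+1.

Lemma pmxE f i j : (pmx f : 'M[R]_N.+1) i j = (f (e j) == Some (e i))%:R.
Proof. by rewrite mxE. Qed.

Lemma mul_pmxE f (x : mxalg N) (o : option I) i j :
  (forall k, (x : 'M[R]_N.+1) k j = (o == Some (e k))%:R) ->
  (pmx f * x : 'M[R]_N.+1) i j = (obind f o == Some (e i))%:R.
Proof.
move=> xj; rewrite -[LHS]/((\matrix_(i, j) (f (e j) == Some (e i))%:R *m (x : 'M[R]_N.+1)) i j).
rewrite mxE; case: o xj => [b|] xj /=; last first.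
  by rewrite big1 // => k _; rewrite xj mulr0.
rewrite (bigD1 (e' b)) //= big1 => [|k kb]; rewrite xj mxE.
  by rewrite e'K eqxx mulr1 addr0.
rewrite (_ : Some b == Some (e k) = false) ?mulr0 //.
by apply/negbTE; apply: contraNneq kb => -[->]; rewrite eK.
Qed.

Lemma pmx_comp f g : pmx f * pmx g = pmx (fun b => obind f (g b)).
Proof.
apply/matrixP => i j; rewrite (@mul_pmxE f (pmx g) (g (e j))) ?pmxE // => k.
by rewrite pmxE.
Qed.

Lemma eq_pmx f g : f =1 g -> pmx f = pmx g.
Proof. by move=> fg; apply/matrixP => i j; rewrite !pmxE fg. Qed.

Lemma pmx0 f : (forall b, f b = None) -> pmx f = 0.
Proof. by move=> f0; apply/matrixP => i j; rewrite pmxE f0 mxE. Qed.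

Lemma pmx_exp f k : pmx f ^+ k.+1 = pmx (fun b => iter k.+1 (obind f) (Some b)).
Proof.
elim: k => [|k IH]; first by rewrite expr1.
by rewrite exprS IH pmx_comp.
Qed.

Lemma prod_pmxE (F : nat -> I -> option I) s i j :
  (\prod_(k <- s) pmx (F k) : 'M[R]_N.+1) i j =
  (foldr (fun k => obind (F k)) (Some (e j)) s == Some (e i))%:R.
Proof.
elim: s i j => [|k s IH] i j /=.
  rewrite big_nil -[LHS]/((1%:M : 'M[R]_N.+1) i j) mxE (eq_sym i).
  by rewrite (inj_eq (@Some_inj _)) (inj_eq (can_inj eK)).
by rewrite big_cons; apply: mul_pmxE => k'; apply: IH.
Qed.

End PartialMapMatrix.

(** * Presented algebras *)

Section AlgMorph.
Variables (R : comPzRingType) (A B : algType R) (f : A -> B).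
Hypothesis fM : alg_morph f.

Lemma alg_morph0 : f 0 = 0.
Proof. by have [fZ _ _ _] := fM; rewrite -(scale0r 0) fZ scale0r. Qed.

Lemma alg_morph_sum (I : Type) (r : seq I) (F : I -> A) :
  f (\sum_(i <- r) F i) = \sum_(i <- r) f (F i).
Proof.
have [_ fD _ _] := fM.
by elim: r => [|i r IH]; rewrite ?big_nil ?alg_morph0 // !big_cons fD IH.
Qed.

Lemma alg_morph_prod (I : Type) (r : seq I) (F : I -> A) :
  f (\prod_(i <- r) F i) = \prod_(i <- r) f (F i).
Proof.
have [_ _ f1 fMul] := fM.
by elim: r => [|i r IH]; rewrite ?big_nil // !big_cons fMul IH.
Qed.

Lemma alg_morphX x k : f (x ^+ k) = f x ^+ k.
Proof. by have [_ _ f1 fMul] := fM; elim: k => // k IH; rewrite !exprS fMul IH. Qed.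

Lemma alg_morph_comp (C : algType R) (g : B -> C) : alg_morph g -> alg_morph (g \o f).
Proof.
have [fZ fD f1 fMul] := fM => -[gZ gD g1 gMul].
by split=> *; rewrite /= ?fZ ?fD ?f1 ?fMul ?gZ ?gD ?g1 ?gMul.
Qed.

Hypothesis f_inj : injective f.
Variables (S : nat -> A) (T : nat -> B).

(** Relations are equations, so they can be checked after an injective morphism; this transfers them
    to a subalgebra. *)
Lemma braid_comm_reflect l : (forall i, (0 < i <= l)%N -> f (S i) = T i) ->
  braid_comm_A l T -> braid_comm_A l S.
Proof.
have [_ _ _ fMul] := fM => fS [braid comm].
by split=> [i i0 il|i j hi hj hij]; apply: f_inj; rewrite !fMul !fS; try lia;
  [apply: braid | apply: comm].
Qed.

Lemma nilcox_reflect l : (forall i, (0 < i <= l)%N -> f (S i) = T i) ->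
  nilcox_rel l T -> nilcox_rel l S.
Proof.
have [_ _ _ fMul] := fM => fS [bc sq]; split; first exact: braid_comm_reflect fS bc.
by move=> i hi; apply: f_inj; rewrite fMul fS // sq // alg_morph0.
Qed.

Lemma ncA_reflect n d : (0 < n)%N -> (forall i, (0 < i <= n)%N -> f (S i) = T i) ->
  ncA_rel n d T -> ncA_rel n d S.
Proof.
have [_ _ _ fMul] := fM => n0 fS [bc sq nilp]; split; first exact: braid_comm_reflect fS bc.
  by move=> i hi; apply: f_inj; rewrite fMul fS ?sq ?alg_morph0 //; lia.
by apply: f_inj; rewrite alg_morphX fS ?n0 ?leqnn // nilp alg_morph0.
Qed.

End AlgMorph.

Section Subalgebra.
Variables (R : comPzRingType) (A : algType R) (P : A -> Prop).
Hypotheses (P1 : P 1) (PD : forall x y, P x -> P y -> P (x + y)).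
Hypotheses (PM : forall x y, P x -> P y -> P (x * y)) (PZ : forall a x, P x -> P (a *: x)).

Definition sub_pred : {pred A} := fun x => `[< P x >].

Lemma sub_pred_closed : GRing.subsemialg_closed sub_pred.
Proof.
split=> [||a x|x y]; rewrite ?unfold_in.
- exact/asboolP.
- split=> [|x y]; rewrite !unfold_in.
    by apply/asboolP; rewrite -(scale0r 1); apply: PZ.
  by move=> /asboolP ? /asboolP ?; apply/asboolP/PD.
- by move=> /asboolP ?; apply/asboolP/PZ.
- by move=> /asboolP ? /asboolP ?; apply/asboolP/PM.
Qed.

HB.instance Definition _ := GRing.isSubalgClosed.Build R A sub_pred sub_pred_closed.

Record subalg := Subalg { subalg_val : A; subalg_valP : subalg_val \in sub_pred }.

HB.instance Definition _ := [isSub for subalg_val].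
HB.instance Definition _ := [Choice of subalg by <:].
HB.instance Definition _ := [SubChoice_isSubAlgebra of subalg by <:].

(* The universal property provides a section of the inclusion of the subalgebra
   of elements satisfying [P]. *)
Lemma presented_ind m (rel : forall B : algType R, (nat -> B) -> Prop) (T : nat -> A) :
  (forall (B C : algType R) (f : B -> C) (S : nat -> B) (S' : nat -> C),
     alg_morph f -> injective f -> (forall i, (0 < i <= m)%N -> f (S i) = S' i) ->
     rel C S' -> rel B S) ->
  presented m rel T -> (forall i, (0 < i <= m)%N -> P (T i)) -> forall x, P x.
Proof.
move=> reflect [relT univ] PT x.
pose S i : subalg := insubd 0 (T i).
have valS i : (0 < i <= m)%N -> val (S i) = T i.
  by move=> hi; rewrite insubdK // unfold_in; apply/asboolP/PT.
have valM : alg_morph (val : subalg -> A).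
  split=> //.
have relS : rel _ S by apply: reflect valM val_inj valS relT.
have [[g [gM gT]] _] := univ _ _ relS.
have [_ uniq] := univ _ _ relT.
have <- : val (g x) = x.
  apply: (uniq (val \o g) id); rewrite ?gT //; first exact: alg_morph_comp.
  by move=> i hi; rewrite /= gT ?valS.
by have := valP (g x); rewrite unfold_in => /asboolP.
Qed.

End Subalgebra.

(** The elements whose left multiplication preserves [V] form a subalgebra containing the
    generators. Thus [V] itself need not be known to be closed under products, which suits a span
    shown only to be a left ideal. *)
Lemma presented_ind_left (R : comPzRingType) (A : algType R) m
  (rel : forall B : algType R, (nat -> B) -> Prop) (T : nat -> A) (V : A -> Prop) :
  (forall (B C : algType R) (f : B -> C) (S : nat -> B) (S' : nat -> C),
     alg_morph f -> injective f -> (forall i, (0 < i <= m)%N -> f (S i) = S' i) ->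
     rel C S' -> rel B S) ->
  presented m rel T -> V 1 -> (forall x y, V x -> V y -> V (x + y)) ->
  (forall a x, V x -> V (a *: x)) ->
  (forall i x, (0 < i <= m)%N -> V x -> V (T i * x)) -> forall x, V x.
Proof.
move=> reflect pres V1 VD VZ VT x; rewrite -[x]mulr1; move: 1 V1.
apply: (@presented_ind _ _ (fun x => forall y, V y -> V (x * y))) reflect pres _ x.
- by move=> y; rewrite mul1r.
- by move=> x y Vx Vy z Vz; rewrite mulrDl; apply: VD; [apply: Vx|apply: Vy].
- by move=> x y Vx Vy z Vz; rewrite -mulrA; apply/Vx/Vy.
- by move=> a x Vx z Vz; rewrite -scalerAl; apply/VZ/Vx.
- by move=> i hi y; apply: VT.
Qed.

(** * The subalgebra generated by the first generators *)

Section GenSubalg.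
Variables (R : comPzRingType) (A : algType R) (T : nat -> A) (l : nat).

Lemma gen_subalgP x : gen_subalg l T x <->
  exists2 ps : seq (R * seq nat), all (fun p => all (fun i => 0 < i <= l)%N p.2) ps &
    x = \sum_(p <- ps) p.1 *: \prod_(i <- p.2) T i.
Proof.
split=> [[ws [c [aw ->]]]|[ps aps ->]].
  exists [seq (c`_k, nth [::] ws k) | k <- iota 0 (size ws)].
    apply/allP => p /mapP[k]; rewrite mem_iota add0n => /= hk ->.
    by apply/(all_nthP [::] aw).
  by rewrite big_map -[in RHS](subn0 (size ws)) -/(index_iota 0 (size ws)) big_mkord.
exists [seq p.2 | p <- ps], [seq p.1 | p <- ps]; split; first by rewrite all_map.
rewrite (big_nth (0, [::])) big_mkord size_map; apply: eq_bigr => k _.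
by rewrite (nth_map (0, [::])) // (nth_map (0, [::])).
Qed.

Lemma gen_subalg1 : gen_subalg l T 1.
Proof.
by apply/gen_subalgP; exists [:: (1, [::])] => //; rewrite big_seq1 big_nil scale1r.
Qed.

Lemma gen_subalgD x y : gen_subalg l T x -> gen_subalg l T y -> gen_subalg l T (x + y).
Proof.
move=> /gen_subalgP[ps aps ->] /gen_subalgP[qs aqs ->]; apply/gen_subalgP.
by exists (ps ++ qs); rewrite ?all_cat ?aps // big_cat.
Qed.

Lemma gen_subalgZ a x : gen_subalg l T x -> gen_subalg l T (a *: x).
Proof.
move=> /gen_subalgP[ps aps ->]; apply/gen_subalgP.
exists [seq (a * p.1, p.2) | p <- ps]; first by rewrite all_map.
by rewrite big_map scaler_sumr; apply: eq_bigr => p _; rewrite scalerA.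
Qed.

Lemma gen_subalg_mull i x : (0 < i <= l)%N -> gen_subalg l T x -> gen_subalg l T (T i * x).
Proof.
move=> hi /gen_subalgP[ps aps ->]; apply/gen_subalgP.
exists [seq (p.1, i :: p.2) | p <- ps].
  by rewrite all_map; apply: sub_all aps => p /= ->; rewrite hi.
by rewrite big_map mulr_sumr; apply: eq_bigr => p _; rewrite big_cons -scalerAr.
Qed.

End GenSubalg.

(** * Spanning and linear independence *)

Section Basis.
Variables (R : comPzRingType) (n d : nat) (A : algType R) (T : nat -> A).
Hypothesis pres : presented n.+1 (@ncA_rel R n.+1 d.+2) T.
Local Notation bas := (@ncA_basis R n.+1 d.+2 A T).

Definition spanned (x : A) : Prop := exists c : {ffun bsym n d -> R}, x = \sum_b c b *: bas b.

Lemma spanned_basis b : spanned (bas b).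
Proof.
exists [ffun b' => (b' == b)%:R]; rewrite (bigD1 b) //= ffunE eqxx scale1r big1 ?addr0 //.
by move=> b' nb; rewrite ffunE (negbTE nb) scale0r.
Qed.

Lemma spannedD x y : spanned x -> spanned y -> spanned (x + y).
Proof.
move=> [c ->] [c' ->]; exists [ffun b => c b + c' b]; rewrite -big_split.
by apply: eq_bigr => b _; rewrite ffunE scalerDl.
Qed.

Lemma spannedZ a x : spanned x -> spanned (a *: x).
Proof.
move=> [c ->]; exists [ffun b => a * c b]; rewrite scaler_sumr.
by apply: eq_bigr => b _; rewrite ffunE scalerA.
Qed.

Lemma ncA_spanned x : spanned x.
Proof.
have [rel _] := pres; have V0 : spanned 0.
  by rewrite -(scale0r (bas (inl 1%g))); apply/spannedZ/spanned_basis.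
apply: (presented_ind_left _ pres) x => [B C f S S' fM fI fS||||].
- exact: (ncA_reflect fM fI (ltn0Sn n) fS).
- by rewrite -(Tw1 (ncA_braid_comm_low rel)); apply: (spanned_basis (inl 1%g)).
- exact: spannedD.
- exact: spannedZ.
move=> i x hi [c ->]; rewrite mulr_sumr.
apply: (big_ind spanned) => // [|b _]; first exact: spannedD.
rewrite -scalerAr; apply: spannedZ; rewrite (mul_ncA_basis rel b hi).
by case: sact => [b'|] //=; apply: spanned_basis.
Qed.

Lemma basis_word_prod b : bas b = \prod_(i <- basis_word b) T i.
Proof.
case: b => [w|[[w k] m]]; first by [].
rewrite ncA_basis_inr /basis_word 2!big_cat big_nseq iter_mulr_1.
exact: esym (mulrA _ _ _).
Qed.

Lemma ncA_coord : exists h : bsym n d -> A -> R,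
  forall (c : {ffun bsym n d -> R}) b, h b (\sum_b' c b' *: bas b') = c b.
Proof.
(* An [algType] is nontrivial, so the existence of [A] forces [1 != 0] in [R]. *)
have nzR : (1 : R) != 0.
  by apply: contraNneq (oner_neq0 A) => e; rewrite -(scale1r 1) e scale0r.
have card_gt0 : (0 < #|{: bsym n d}|)%N by apply/card_gt0P; exists (inl 1%g).
have [N cardN] : {N | #|{: bsym n d}| = N.+1} by exists #|{: bsym n d}|.-1; lia.
pose e (i : 'I_N.+1) : bsym n d := enum_val (cast_ord (esym cardN) i).
pose e' (b : bsym n d) : 'I_N.+1 := cast_ord cardN (enum_rank b).
have eK : cancel e e' by move=> i; rewrite /e /e' enum_valK cast_ordKV.
have e'K : cancel e' e by move=> b; rewrite /e /e' cast_ordK enum_rankK.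
pose S i := pmx nzR e (sact i).
have relS : ncA_rel n.+1 d.+2 S.
  have pc := @pmx_comp _ nzR _ _ e e' eK e'K.
  split; first split.
  - move=> i i0 ilt; rewrite /S -!mulrA !pc; apply: eq_pmx => b /=.
    have [->|] := eqVneq i n; first by rewrite sact_braid_last //; lia.
    by move=> ne; rewrite sact_braid_low //; lia.
  - move=> i j hi hj hij; rewrite /S !pc; apply: eq_pmx => b /=.
    have [e1|ni] := eqVneq i n.+1.
      by rewrite e1 -sact_comm_last //; lia.
    have [e1|nj] := eqVneq j n.+1.
      by rewrite e1 sact_comm_last //; lia.
    by apply: sact_comm_low; lia.
  - by move=> i hi; rewrite /S pc; apply: pmx0 => b; apply: sact_sq; lia.
  - rewrite /S (pmx_exp _ eK e'K); apply: pmx0 => b.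
    rewrite -[RHS](sact_last_nilp b); apply: eq_iter => -[] //= b'.
    by rewrite /sact ltnn.
have [_ univ] := pres; have [[F [FM FT]] _] := univ _ _ relS.
have [FZ _ _ _] := FM.
(* Row [b] of the column indexed by the symbol of 1. *)
exists (fun b x => (F x : 'M[R]_N.+1) (e' b) (e' (inl 1%g))) => c b.
have Fb b' : (F (bas b') : 'M[R]_N.+1) (e' b) (e' (inl 1%g)) = (b' == b)%:R.
  rewrite basis_word_prod (alg_morph_prod FM).
  have -> : \prod_(i <- basis_word b') F (T i) = \prod_(i <- basis_word b') S i.
    rewrite big_seq [RHS]big_seq; apply: eq_bigr => i hi; apply: FT.
    by have /allP := basis_word_letters b'; apply.
  rewrite (prod_pmxE _ eK e'K) !e'K.
  by rewrite -/(run (basis_word b') (Some (inl 1%g))) run_basis_word.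
rewrite (alg_morph_sum FM).
transitivity (\sum_b' c b' * (b' == b)%:R); last first.
  rewrite (bigD1 b) //= eqxx mulr1 big1 ?addr0 // => b' nb.
  by rewrite (negbTE nb) mulr0.
rewrite -[LHS]/((\sum_b' (F (c b' *: bas b') : 'M[R]_N.+1)) _ _) summxE.
apply: eq_bigr => b' _; rewrite FZ -Fb.
by rewrite -[LHS]/((c b' *: (F (bas b') : 'M[R]_N.+1)) _ _) mxE.
Qed.

End Basis.

(** * The nil-Coxeter subalgebras and the final assembly *)

Lemma ncA_rel_extend0 (R : comPzRingType) (n d l : nat) (B : algType R) (U : nat -> B) :
  (0 < d)%N -> (l < n)%N -> nilcox_rel l U ->
  ncA_rel n d (fun i => if (i <= l)%N then U i else 0).
Proof.
move=> d0 ln [[braid comm] sq]; split; first split.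
- move=> i i0 iltn; case: leqP => [il|li]; case: leqP => [il'|li']; try lia;
    rewrite ?mulr0 ?mul0r //; by apply: braid.
- move=> i j hi hj hij; case: leqP => [il|li]; case: leqP => [jl|lj]; rewrite ?mulr0 ?mul0r //.
  by apply: comm; lia.
- by move=> i hi; case: leqP => il; rewrite ?mulr0 // sq //; lia.
by rewrite leqNgt ln /= expr0n; case: d d0.
Qed.

Theorem theoremB (R : comPzRingType) (n d : nat) (hn : (1 <= n)%N) (hd : (2 <= d)%N)
  (A : algType R) (T : nat -> A)
  (hA : presented n (@ncA_rel R n d) T) :
  (* NC_A(n,d) is free with the stated basis: unique coordinates *)
  (forall x : A, exists c : {ffun 'S_n + ('S_n * 'I_(d.-1) * 'I_n) -> R},
      x = \sum_b c b *: @ncA_basis R n d A T b /\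
      forall c' : {ffun 'S_n + ('S_n * 'I_(d.-1) * 'I_n) -> R},
        x = \sum_b c' b *: @ncA_basis R n d A T b -> c' = c) /\
  (* R_l is isomorphic to the nil-Coxeter algebra of type A_l, via T_i |-> T_i *)
  (forall l, (1 <= l <= n.-1)%N ->
   forall (B : algType R) (U : nat -> B), presented l (@nilcox_rel R l) U ->
   exists phi : B -> A,
     [/\ alg_morph phi, injective phi,
         forall i, (0 < i <= l)%N -> phi (U i) = T i &
         forall x : A, gen_subalg l T x <-> exists y, phi y = x]).
Proof.
split.
  case: n hn A T hA => // n _; case: d hd => [|[|d]] // _ A T pres x.
  have [c ->] := ncA_spanned pres x; exists c; split=> // c' e.
  have [h hc] := ncA_coord pres.
  by apply/ffunP => b; rewrite -hc -(hc c b) -e.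
move=> l hl B U presB; have [relA univA] := hA; have [relB univB] := presB.
have relT : nilcox_rel l T.
  have [[braid comm] sq _] := relA.
  split; first by split=> [i ? ?|i j ? ? ?]; [apply: braid|apply: comm]; lia.
  by move=> i hi; apply: sq; lia.
have [[phi [phiM phiU]] _] := univB _ _ relT.
have relS : ncA_rel n d (fun i => if (i <= l)%N then U i else 0).
  by apply: ncA_rel_extend0 relB; lia.
have [[psi [psiM psiT]] _] := univA _ _ relS.
have [_ uniqB] := univB _ _ relB.
(* [psi \o phi] fixes every generator [U i], hence is the identity by uniqueness. *)
have psiK : cancel phi psi.
  move=> y; apply: (uniqB (psi \o phi) id) => //; first exact: alg_morph_comp.
  by move=> i hi; rewrite /= phiU // psiT ?(proj2 (andP hi)) //; lia.
exists phi; split=> //; first exact: can_inj psiK.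
have [phiZ phiD phi1 phiMul] := phiM.
move=> x; split=> [/gen_subalgP[ps aps ->]|[y <-]].
  (* A preimage is the same combination of words with [U] in place of [T]. *)
  exists (\sum_(p <- ps) p.1 *: \prod_(i <- p.2) U i).
  rewrite (alg_morph_sum phiM) big_seq [RHS]big_seq; apply: eq_bigr => p /(allP aps)/allP ap.
  rewrite phiZ (alg_morph_prod phiM) big_seq [in RHS]big_seq; congr (_ *: _).
  by apply: eq_bigr => i /ap; apply: phiU.
apply: (presented_ind_left (V := fun y => gen_subalg l T (phi y)) _ presB) y
  => [B' C f S S' fM fI fS||||].
- exact: (nilcox_reflect fM fI fS).
- by rewrite phi1; apply: gen_subalg1.
- by move=> u v; rewrite phiD; apply: gen_subalgD.
- by move=> a u; rewrite phiZ; apply: gen_subalgZ.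
- by move=> i u hi; rewrite phiMul phiU //; apply: gen_subalg_mull.
Qed.
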